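(* Let $0\le r<n$ be integers. Let $w=(w[1]\cdots w[a^n])$ be an $(a,n,n+r)$-perfect necklace, where each $w[p]$ is a word of length $n+r$. Then for every integer $q\ge 1$, $v=(v[1]\cdots v[a^n])$ is an $(a,n,nq+r)$-perfect necklace, where $v[p]=(w[p]_1\cdots w[p]_n)^q\,w[p]_{n+1}\cdots w[p]_{n+r}$ for each $p\in\{1,\dots,a^n\}$.
   Context: A cyclic word $(v_1\cdots v_N)$ is a cyclically ordered sequence of letters, with indices taken modulo $N$. An $(a,n,t)$-perfect necklace is a cyclic word $v$ over $\{0,\dots,a-1\}$ of length $t\cdot a^n$ such that for every $j\in\{1,\dots,t\}$, each word of $\{0,\dots,a-1\}^n$ equals $v_iv_{i+1}\cdots v_{i+n-1}$ for a unique $i\in\{1,\dots,ta^n\}$ with $i\equiv j\pmod t$. Juxtaposition of words denotes concatenation, $x^q$ is the concatenation of $q$ copies of $x$, and $w[p]_i$ is the $i$th letter of the word $w[p]$. *)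

(* Defs.v *)
From mathcomp Require Import all_boot.

Set Implicit Arguments.
Unset Strict Implicit.
Unset Printing Implicit Defensive.

Definition is_word (a : nat) (s : seq nat) : bool := all (fun x => x < a) s.

(* A cyclic word (v_1 ... v_N) is given by any of its linearizations v; letters
   are numbered from 1, so that cyc_letter v i is v_i for every i >= 1, with i
   taken modulo N.  The default value 0 is reached only when v is empty. *)
Definition cyc_letter (v : seq nat) (i : nat) : nat :=
  nth 0 v (i.-1 %% size v).

(* v_i v_{i+1} ... v_{i+n-1}; it may wrap around v, even several times. *)
Definition cyc_factor (v : seq nat) (i n : nat) : seq nat :=
  [seq cyc_letter v k | k <- iota i n].

Definition perfect_necklace (a n t : nat) (v : seq nat) : Prop :=
  [/\ size v = t * a ^ n,
      is_word a v
    & forall j : nat, 1 <= j <= t ->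
      forall u : seq nat, size u = n -> is_word a u ->
      exists! i : nat,
        [/\ 1 <= i <= t * a ^ n, i = j %[mod t] & cyc_factor v i n = u]].

Definition word_pow (x : seq nat) (q : nat) : seq nat := flatten (nseq q x).

Definition pump_block (n q : nat) (x : seq nat) : seq nat :=
  word_pow (take n x) q ++ drop n x.

(* Main.v *)
(* A length-n window of v starting at offset j of block p is of one of two kinds.
   If j <= n(q-1), it lies inside the power (w[p]_1 ... w[p]_n)^q, so it is a
   rotation of the window of w starting block p; rotation being a bijection on
   words, uniqueness follows from the case j = 1 of the hypothesis.  Otherwise it
   coincides with the window of w at offset j - n(q-1) of block p, because the
   part that leaves the block is shorter than n and both v[p+1] and w[p+1] begin
   with the same n letters. *)
Require Import Defs.
From mathcomp Require Import all_boot.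
From mathcomp Require Import zify.

Set Implicit Arguments.
Unset Strict Implicit.
Unset Printing Implicit Defensive.

Lemma eq_unique_exists (T : Type) (P Q : T -> Prop) :
  (forall x, P x <-> Q x) -> (exists! x, P x) -> exists! x, Q x.
Proof.
move=> PQ [x [Px xP]]; exists x; split; first exact/PQ.
by move=> y /PQ; apply: xP.
Qed.

(** Division by [t] turns a position of fixed residue into a block index [p]. Corresponding blocks
    of the two necklaces share this index although their block lengths differ, so uniqueness can be
    carried from one to the other. The residues 1 to [t] are written [j.+1] with [j < t]. *)
Lemma unique_exists_residue (t M j : nat) (P : nat -> Prop) : j < t ->
  (exists! i, [/\ 1 <= i <= t * M, i = j.+1 %[mod t] & P i]) <->
  (exists! p, p < M /\ P (p * t + j.+1)).
Proof.
move=> jt; have t0 : 0 < t by lia.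
have toP i : 1 <= i <= t * M -> i = j.+1 %[mod t] ->
    exists2 p, p < M & i = p * t + j.+1.
  case: i => [//|i] /= iM /eqP.
  rewrite -(addn1 i) -(addn1 j) eqn_modDr (modn_small jt) => /eqP ij.
  exists (i %/ t); first by rewrite ltn_divLR // mulnC.
  by rewrite addnA {1}(divn_eq i t) ij.
have ofP p : p < M ->
    1 <= p * t + j.+1 <= t * M /\ p * t + j.+1 = j.+1 %[mod t].
  by move=> pM; split; [nia | rewrite modnMDl].
split=> [[i [[iM ij Pi] iP]] | [p [[pM Pp] pP]]].
- have [p pM ip] := toP _ iM ij; rewrite ip in Pi iP.
  exists p; split=> // p' [p'M Pp'].
  have [h1 h2] := ofP _ p'M.
  have := iP _ (And3 h1 h2 Pp').
  by move/addIn/eqP; rewrite eqn_pmul2r // => /eqP.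
- have [h1 h2] := ofP _ pM.
  exists (p * t + j.+1); split=> // i [iM ij Pi].
  have [p' p'M ip] := toP _ iM ij; rewrite ip in Pi *.
  by rewrite (pP p').
Qed.

Lemma nth_cyc_factor v i n k : k < n ->
  nth 0 (cyc_factor v i n) k = cyc_letter v (i + k).
Proof. by move=> kn; rewrite (nth_map 0) ?size_iota // nth_iota. Qed.

Lemma size_cyc_factor v i n : size (cyc_factor v i n) = n.
Proof. by rewrite size_map size_iota. Qed.

Section UniformBlocks.

Variables (t : nat) (s : seq (seq nat)).
Hypothesis blocks : forall x, x \in s -> size x = t.

Lemma size_flatten_uniform : size (flatten s) = t * size s.
Proof.
elim: s blocks => [|x s' IH] bl /=; first by rewrite muln0.
rewrite size_cat IH ?mulnS => [|y ys]; last by apply: bl; rewrite inE ys orbT.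
by rewrite bl ?mem_head.
Qed.

Lemma nth_flatten_uniform p j : j < t ->
  nth 0 (flatten s) (p * t + j) = nth 0 (nth [::] s p) j.
Proof.
move=> jt; elim: s blocks p => [|x s' IH] bl p /=; first by rewrite !nth_nil.
have xt : size x = t by rewrite bl ?mem_head.
rewrite nth_cat xt; case: p => [|p] /=; first by rewrite mul0n add0n jt.
rewrite mulSn -addnA ltnNge leq_addr /= addKn IH // => y ys.
by apply: bl; rewrite inE ys orbT.
Qed.

(** The index [p] is unbounded, so that a window running past the last block is read from the first
    block on. *)
Lemma cyc_letter_flatten p j : j < t ->
  cyc_letter (flatten s) (p * t + j.+1) =
  nth 0 (nth [::] s (p %% size s)) j.
Proof.
move=> jt; rewrite /cyc_letter size_flatten_uniform addnS /=.
rewrite -(nth_flatten_uniform _ jt); congr (nth 0 _ _).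
rewrite {1}(divn_eq p (size s)) mulnDl -mulnA (mulnC (size s)) -addnA modnMDl.
(* Without blocks both moduli are 0, and reduction modulo 0 is the identity. *)
case: (posnP (size s)) => [-> | s0]; first by rewrite muln0 !modn0.
by rewrite modn_small //; have := ltn_pmod p s0; nia.
Qed.

End UniformBlocks.

Lemma size_word_pow x q : size (word_pow x q) = size x * q.
Proof. by rewrite size_flatten /shape map_nseq sumn_nseq. Qed.

Section PumpBlock.

Variables (n q : nat) (x : seq nat).
Hypothesis n_le : n <= size x.

Lemma size_pump_block : size (pump_block n q x) = n * q + (size x - n).
Proof. by rewrite size_cat size_word_pow size_takel // size_drop. Qed.

Lemma nth_pump_block_power i : i < n * q ->
  nth 0 (pump_block n q x) i = nth 0 x (i %% n).
Proof.
move=> iq; have n0 : 0 < n by case: (n) iq.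
rewrite nth_cat size_word_pow size_takel // iq.
rewrite {1}(divn_eq i n) (@nth_flatten_uniform n) ?ltn_pmod //.
  by rewrite nth_nseq ltn_divLR // mulnC iq nth_take ?ltn_pmod.
by move=> y /nseqP[-> _]; rewrite size_takel.
Qed.

(** The last copy of [take n x] followed by [drop n x] is [x] again. *)
Lemma nth_pump_block_suffix i : 0 < q ->
  nth 0 (pump_block n q x) (n * q.-1 + i) = nth 0 x i.
Proof.
move=> q0; have nq : n * q = n * q.-1 + n by rewrite -mulnSr prednK.
case: (ltnP i n) => [i_n | ni].
  by rewrite nth_pump_block_power ?nq ?ltn_add2l // mulnC modnMDl modn_small.
rewrite nth_cat size_word_pow size_takel // nq ltn_add2l ltnNge ni /=.
by rewrite nth_drop subnDl subnKC.
Qed.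

End PumpBlock.

Lemma all_flatten (T : Type) (P : pred T) (ss : seq (seq T)) :
  all P (flatten ss) = all (all P) ss.
Proof. by elim: ss => //= x ss IH; rewrite all_cat IH. Qed.

Lemma is_word_pump_block a n q x :
  is_word a x -> is_word a (pump_block n q x).
Proof.
move=> xa; rewrite /is_word all_cat all_flatten all_nseq.
move: xa; rewrite /is_word -{1}(cat_take_drop n x) all_cat => /andP[-> ->].
by rewrite orbT.
Qed.

Section Windows.

Variables (n r q : nat) (w : seq (seq nat)).
Hypothesis blocks : forall x, x \in w -> size x = n + r.
Hypothesis q_gt0 : 0 < q.

Let v := [seq pump_block n q x | x <- w].

Lemma size_pumped_block x : x \in v -> size x = n * q + r.
Proof.
move=> /mapP[y yw ->]; rewrite size_pump_block (blocks yw) ?leq_addr //.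
by rewrite addKn.
Qed.

(** Here [p] witnesses that [w] is nonempty, while [p'] may lie beyond the last block. *)
Let size_nth_mod p : p < size w ->
  forall p', n <= size (nth [::] w (p' %% size w)).
Proof.
move=> pw p'; rewrite blocks ?leq_addr // mem_nth // ltn_pmod //.
by case: (size w) pw.
Qed.

Let cyc_letter_pumped p p' j : p < size w -> j < n * q + r ->
  cyc_letter (flatten v) (p' * (n * q + r) + j.+1) =
  nth 0 (pump_block n q (nth [::] w (p' %% size w))) j.
Proof.
move=> pw jt; rewrite (cyc_letter_flatten size_pumped_block) // size_map.
by rewrite (nth_map [::]) // ltn_pmod //; case: (size w) pw.
Qed.

Lemma cyc_factor_pumped_power p j : p < size w -> j <= n * q.-1 ->
  cyc_factor (flatten v) (p * (n * q + r) + j.+1) n =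
  rot (j %% n) (cyc_factor (flatten w) (p * (n + r) + 1) n).
Proof.
move=> pw jq; have nq : n * q = n * q.-1 + n by rewrite -mulnSr prednK.
apply: (@eq_from_nth _ 0); first by rewrite size_rot !size_cyc_factor.
rewrite size_cyc_factor => k kn.
have n0 : 0 < n by case: (n) kn.
have jn := ltn_pmod j n0.
have first_window i : i < n ->
    nth 0 (cyc_factor (flatten w) (p * (n + r) + 1) n) i
    = nth 0 (nth [::] w (p %% size w)) i.
  move=> i_n; rewrite nth_cyc_factor // -addnA add1n.
  by rewrite (cyc_letter_flatten blocks) // ltn_addr.
have jk : j + k < n * q by rewrite nq -addnS leq_add.
rewrite nth_cyc_factor // -addnA addSn (cyc_letter_pumped _ pw) ?ltn_addr //.
rewrite nth_pump_block_power //; last exact: size_nth_mod pw p.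
rewrite /rot nth_cat size_drop size_cyc_factor nth_drop.
(* The two cases are the two pieces of the rotation: [j %% n + k] either stays below [n] or wraps
   around once. *)
rewrite -modnDml; case: ltnP => h.
  have jkn : j %% n + k < n by lia.
  by rewrite first_window // (modn_small jkn).
rewrite nth_take ?first_window; try lia.
congr nth; rewrite -(@modn_small (k - (n - j %% n)) n); last by lia.
by rewrite -(modnDr (k - _)); congr (_ %% _); lia.
Qed.

Lemma cyc_factor_pumped_suffix p j : p < size w -> j < n + r ->
  cyc_factor (flatten v) (p * (n * q + r) + (n * q.-1 + j).+1) n =
  cyc_factor (flatten w) (p * (n + r) + j.+1) n.
Proof.
move=> pw jt; have nq : n * q = n * q.-1 + n by rewrite -mulnSr prednK.
apply: (@eq_from_nth _ 0); first by rewrite !size_cyc_factor.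
rewrite size_cyc_factor => k kn; rewrite !nth_cyc_factor //.
(* Skipping [n * q.-1] letters leaves as many letters in the pumped block as in the original one, so
   both windows cross into the next block at the same [k]. *)
case: (ltnP (j + k) (n + r)) => h.
  have -> : p * (n * q + r) + (n * q.-1 + j).+1 + k
          = p * (n * q + r) + (n * q.-1 + (j + k)).+1 by lia.
  rewrite -(addnA _ j.+1) addSn.
  rewrite (cyc_letter_pumped _ pw) ?nq ?(cyc_letter_flatten blocks) //.
    by rewrite nth_pump_block_suffix //; apply: size_nth_mod pw p.
  by rewrite -addnA ltn_add2l.
have kE : j + k = (n + r) + (j + k - (n + r)) by rewrite subnKC.
(* As [j < n + r] and [k < n], the overhang [l] falls among the first [n] letters of the next block,
   which pumping preserves. *)
set l := j + k - (n + r) in kE; have ln : l < n by lia.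
have -> : p * (n * q + r) + (n * q.-1 + j).+1 + k
        = p.+1 * (n * q + r) + l.+1 by rewrite mulSn; lia.
have -> : p * (n + r) + j.+1 + k = p.+1 * (n + r) + l.+1 by rewrite mulSn; lia.
have lq : l < n * q by rewrite nq ltn_addl.
rewrite (cyc_letter_pumped _ pw) ?ltn_addr //.
rewrite (cyc_letter_flatten blocks) ?ltn_addr // nth_pump_block_power ?(modn_small ln) //.
exact: size_nth_mod pw _.
Qed.

End Windows.

Theorem proposition4p1 (a n r : nat) (hrn : r < n)
    (w : seq (seq nat)) (hsize : size w = a ^ n)
    (hblocks : forall x : seq nat, x \in w -> size x = n + r)
    (hw : perfect_necklace a n (n + r) (flatten w))
    (q : nat) (hq : 1 <= q) :
  perfect_necklace a n (n * q + r)
    (flatten [seq pump_block n q x | x <- w]).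
Proof.
have [_ wa wP] := hw; split.
- by rewrite (size_flatten_uniform (size_pumped_block hblocks)) size_map hsize.
- move: wa; rewrite /is_word !all_flatten all_map => /allP wa.
  by apply/allP=> x xw /=; apply: is_word_pump_block; apply: wa.
have nq : n * q = n * q.-1 + n by rewrite -mulnSr prednK.
case=> [//|j] jt u un ua; apply/unique_exists_residue; first by [].
case: (leqP j (n * q.-1)) => jq.
(* The window that starts the block has to be [u] rotated back by [j %% n]; it is located by the
   hypothesis for residue 1, that is, offset 0. *)
- have u'a : is_word a (rotr (j %% n) u).
    by rewrite /is_word (eq_all_r (mem_rotr _ u)).
  have nr0 : 0 < n + r by lia.
  have := wP 1 nr0 _ (etrans (size_rotr _ u) un) u'a.
  move/(unique_exists_residue _ _ nr0); apply: eq_unique_exists => p; split=> -[pM pE];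
    split=> //; move: pE; rewrite cyc_factor_pumped_power ?hsize // => pE.
    by rewrite pE rotrK.
  by rewrite -pE rotK.
- have jE : j = n * q.-1 + (j - n * q.-1) by rewrite subnKC // ltnW.
  (* Since [n * q + r = n * q.-1 + (n + r)], the remaining offset is a valid one in a block of
     [w]. *)
  set j1 := j - n * q.-1 in jE; have j1t : j1 < n + r by lia.
  have := wP j1.+1 j1t u un ua.
  move/(unique_exists_residue _ _ j1t); rewrite jE; apply: eq_unique_exists => p.
  by split=> -[pM pE]; split=> //; move: pE; rewrite cyc_factor_pumped_suffix ?hsize.
Qed.
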